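(* For any empirical risk minimization (ERM) algorithm $\mathcal A$ over a hypothesis class $\mathcal H$ with $|\mathcal H|\ge2$, for classification with 0--1 loss, the minimax cross-validation risk satisfies, as $n\to\infty$, $$\mathfrak R_{\mathrm{CV}}(\mathcal A)=\Omega\!\left(\frac{\sqrt{k^*}}{n}\right),$$ where $k^*=k^*(n)$ is the number of folds that achieves the minimax optimum, i.e. attains the minimum over $k$ in the definition of $\mathfrak R_{\mathrm{CV}}(\mathcal A)$.
   Context: Let $\mathcal X$ be the input space, $\mathcal Y$ a (binary or multiclass) label set, and $\mathcal H\subseteq\mathcal Y^{\mathcal X}$ a hypothesis class. A (possibly randomized) learning rule $\mathcal A$ maps finite samples from $\mathcal X\times\mathcal Y$ to elements of $\mathcal H$ and is permutation-invariant. $\mathcal A$ is an ERM algorithm over $\mathcal H$ if on every sample $S$ it outputs an $h\in\mathcal H$ minimizing the empirical 0--1 error $\frac1{|S|}\sum_{(x,y)\in S}\mathbf 1\{h(x)\ne y\}$ (ties broken arbitrarily). For a distribution $\mathcal D$ on $\mathcal X\times\mathcal Y$, an i.i.d. sample $S^n\sim\mathcal D^n$, and $k\ge2$ with $k\mid n$, partition $S^n$ into $k$ disjoint folds $S_1,\dots,S_k$ of size $m=n/k$, put $S_{-i}=S^n\setminus S_i$, $\widehat L_i=\frac1m\sum_{(x,y)\in S_i}\mathbf 1\{\mathcal A(S_{-i})(x)\ne y\}$, $\widehat L_{\mathrm{CV}}^{(k)}=\frac1k\sum_{i=1}^k\widehat L_i$, and $$\mathrm{MSE}^{(k)}_{\mathrm{CV}}(\mathcal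 A,\mathcal D)=\mathbb E_{S^n\sim\mathcal D^n,\mathcal A}\big[(\widehat L_{\mathrm{CV}}^{(k)}-L(\mathcal A(S^n)))^2\big],\qquad L(h)=\mathbb P_{(x,y)\sim\mathcal D}[h(x)\ne y].$$ The minimax cross-validation risk (for sample size $n$) is $$\mathfrak R_{\mathrm{CV}}(\mathcal A):=\min_{k\mid n}\max_{\mathcal D}\mathrm{MSE}^{(k)}_{\mathrm{CV}}(\mathcal A,\mathcal D),$$ where the minimum is over integers $k\ge2$ dividing $n$ and the maximum (understood as a supremum) is over all distributions $\mathcal D$ on $\mathcal X\times\mathcal Y$. $a_n=\Omega(b_n)$ means there is a constant $c>0$ with $a_n\ge c\,b_n$ for all sufficiently large $n$. *)

(* Defs.v *)
From HB Require Import structures.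
From mathcomp Require Import all_boot all_order all_algebra.
From mathcomp Require Import all_classical all_reals all_analysis.

Set Implicit Arguments.
Unset Strict Implicit.
Unset Printing Implicit Defensive.

Import Order.TTheory GRing.Theory Num.Theory.
Import numFieldNormedType.Exports.

Local Open Scope classical_set_scope.
Local Open Scope ring_scope.

Section iid_sample.
Context d (T : measurableType d) (R : realType).

Definition tcons n (z : T * n.-tuple T) : n.+1.-tuple T := [tuple of z.1 :: z.2].

Lemma measurable_tcons n : measurable_fun [set: T * n.-tuple T] (@tcons n).
Proof. exact: measurable_cons measurable_fst measurable_snd. Qed.

HB.instance Definition _ n :=
  isMeasurableFun.Build _ _ _ _ (@tcons n) (@measurable_tcons n).

(* The n-fold product measure, as a probability measure on n.-tuple T. *)
Fixpoint iid (P : probability T R) (n : nat) : probability (n.-tuple T) R :=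
  match n with
  | 0 => \d_ [tuple]
  | n'.+1 => distribution (P \x iid P n')%E (@tcons n')
  end.

End iid_sample.

Section errors.
Context dX dY (X : measurableType dX) (Y : measurableType dY) (R : realType).

Definition emp_err (h : X -> Y) (S : seq (X * Y)) : R :=
  (\sum_(z <- S) (h z.1 != z.2)%:R) / (size S)%:R.

Definition true_err (D : probability (X * Y)%type R) (h : X -> Y) : R :=
  fine (D [set z | h z.1 != z.2]).

End errors.

(* Contiguous blocks; when k divides size S and m = size S %/ k, the blocks
   i = 0, ..., k - 1 partition S. *)
Definition fold (T : Type) (m i : nat) (S : seq T) : seq T :=
  take m (drop (i * m) S).

Definition off_fold (T : Type) (m i : nat) (S : seq T) : seq T :=
  take (i * m) S ++ drop (i.+1 * m) S.

Section learning.
Context dX dY dW (X : measurableType dX) (Y : measurableType dY)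
  (W : measurableType dW) (R : realType).

(* A randomized learning rule reads a random seed w : W of law P:
   A S w is the hypothesis returned on the sample S with seed w. *)
Implicit Types (H : set (X -> Y)) (P : probability W R)
  (A : seq (X * Y) -> W -> X -> Y).

(* The random function A S has the same law for all orderings of S: its
   finite-dimensional distributions coincide. *)
Definition perm_invariant P A : Prop :=
  forall S S' : seq (X * Y), perm_eq S S' ->
  forall (r : nat) (x : 'I_r -> X) (B : 'I_r -> set Y),
    (forall i, measurable (B i)) ->
    P [set w | forall i, B i (A S w (x i))]
    = P [set w | forall i, B i (A S' w (x i))].

Definition jointly_measurable A : Prop :=
  forall n, measurable_fun setT
    (fun z : n.-tuple (X * Y)%type * (W * X) => A z.1 z.2.1 z.2.2).

Definition learning_rule H P A : Prop :=
  [/\ forall S w, H (A S w), perm_invariant P A & jointly_measurable A].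

Definition is_ERM H A : Prop :=
  forall S w, H (A S w) /\
    forall h, H h -> emp_err R (A S w) S <= emp_err R h S.

(* The k training runs use the seeds w_0, ..., w_{k-1}. *)
Definition cv_estimate A (n k : nat) (S : n.-tuple (X * Y)%type)
    (w : k.-tuple W) : R :=
  (\sum_(i < k) emp_err R (A (off_fold (n %/ k) i S) (tnth w i))
                        (fold (n %/ k) i S)) / k%:R.

(* Expectation over the i.i.d. sample S = z.1, the seed z.2.1 of the run on the
   full sample and the seeds z.2.2 of the k training runs, all independent. *)
Definition cv_mse P A (n k : nat) (D : probability (X * Y)%type R) : \bar R :=
  (\int[iid D n \x (P \x iid P k)]_z
    ((cv_estimate A z.1 z.2.2 - true_err D (A z.1 z.2.1)) ^+ 2)%:E)%E.

Definition worst_cv_mse P A (n k : nat) : \bar R :=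
  ereal_sup [set cv_mse P A n k D | D in [set: probability (X * Y)%type R]].

Definition fold_counts (n : nat) : set nat :=
  [set k | (2 <= k)%N /\ (k %| n)%N].

Definition cv_risk P A (n : nat) : \bar R :=
  ereal_inf [set worst_cv_mse P A n k | k in fold_counts n].

Definition optimal_folds P A (n k : nat) : Prop :=
  fold_counts n k /\ worst_cv_mse P A n k = cv_risk P A n.

End learning.

Definition is_Omega (R : realType) (a : nat -> \bar R) (b : nat -> R) : Prop :=
  exists2 c : R, 0 < c & \forall n \near \oo, ((c * b n)%:E <= a n)%E.

(* Main.v *)
Require Import Defs.
From HB Require Import structures.
From mathcomp Require Import all_boot all_order all_algebra.
From mathcomp Require Import all_classical all_reals all_analysis.
From mathcomp Require Import measurable_realfun.
From mathcomp Require Import zify ring lra.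

Set Implicit Arguments.
Unset Strict Implicit.
Unset Printing Implicit Defensive.

Import Order.TTheory GRing.Theory Num.Theory.

Local Open Scope classical_set_scope.
Local Open Scope ring_scope.

(** Two hypotheses of the class disagree at some point x, say with labels
    y1 <> y2 there.  The hard distribution puts all its mass on x and draws the
    label by a fair coin between y1 and y2.  Any hypothesis that answers y1 or
    y2 at x has true error exactly 1/2, and empirical risk minimization answers
    with the majority label of its sample ([ERM_majority]); only ties are left
    to the rule.

    Encode labels as signs +1 and -1, let F_i be the sum of the signs in fold i
    and T the sum of all signs.  The cross-validation error of fold i then
    differs from 1/2 by - s_i F_i / (2m), where s_i is the vote of the rule
    trained off fold i: the sign of T - F_i, or a random sign if T = F_i.  Given
    the sample, the seeds of the k runs are averaged out by Jensen's inequality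
    ([sqr_integral_le]); permutation invariance makes the mean vote on a tie a
    constant tau, the same for all folds ([mean_vote_tie_sign]).  The mean
    squared error is thus at least 1/(4n^2) times the mean of
      (sum_i sg(T - F_i) F_i)^2,   sg 0 = tau   ([cv_mse_seed_ge]).

    In the expansion of this square take i <> j and let U be the sum of the
    other k - 2 folds.  Since T - F_i = U + F_j and T - F_j = U + F_i, the cross
    term factors given U: it is the mean of g(U)^2 with
    g(u) = E[sg(u + F) F]   ([mean_majority_cv_cross]).  So all cross terms are
    nonnegative, and they accumulate: by the symmetry of F,
    g(u) + g(-u) >= sqrt m / 4 as soon as |u| is at most a small multiple of
    sqrt m   ([fold_gain_ge]), while |U|, whose typical size is sqrt(k m), is
    that small with probability at least a constant times 1 / sqrt k
    ([mean_window_ge]).  The k(k-1) cross terms contribute at least a constant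
    times k^2 . m . 1/sqrt k = n sqrt k, and dividing by n^2 yields
    sqrt k / n. *)

(** * Sums of fair coin flips *)

Section FairCoins.
Variable R : rcfType.
Implicit Types s t : seq bool.

(** The expectation of [f] over [n] independent fair coin flips.  The recursion
    on the first flip is that of [iid], and [mean_cat] turns the independence of
    consecutive blocks of flips into nested means. *)
Fixpoint mean n (f : seq bool -> R) : R :=
  if n is n'.+1 then
    (mean n' (fun s => f (true :: s)) + mean n' (fun s => f (false :: s))) / 2
  else f [::].

Lemma eq_mean n (f g : seq bool -> R) :
  (forall s, size s = n -> f s = g s) -> mean n f = mean n g.
Proof.
elim: n f g => [|n IHn] f g eq_fg /=; first exact: eq_fg.
by congr ((_ + _) / 2); apply: IHn => s sz_s; apply: eq_fg; rewrite /= sz_s.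
Qed.

Lemma le_mean n (f g : seq bool -> R) :
  (forall s, size s = n -> f s <= g s) -> mean n f <= mean n g.
Proof.
elim: n f g => [|n IHn] f g le_fg /=; first exact: le_fg.
by rewrite ler_pM2r ?invr_gt0// lerD// IHn// => s sz_s; apply: le_fg;
   rewrite /= sz_s.
Qed.

Lemma mean_const n (c : R) : mean n (fun=> c) = c.
Proof. by elim: n => //= n ->; field. Qed.

Lemma meanD n (f g : seq bool -> R) : mean n (fun s => f s + g s) = mean n f + mean n g.
Proof. by elim: n f g => //= n IHn f g; rewrite !IHn; field. Qed.

Lemma meanZ n (c : R) (f : seq bool -> R) : mean n (fun s => c * f s) = c * mean n f.
Proof. by elim: n f => //= n IHn f; rewrite !IHn; field. Qed.

Lemma mean_sum n (I : Type) (r : seq I) (p : pred I) (F : I -> seq bool -> R) :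
  mean n (fun s => \sum_(i <- r | p i) F i s) = \sum_(i <- r | p i) mean n (F i).
Proof.
elim: r => [|i r IHr].
  by rewrite big_nil -[RHS](mean_const n); apply: eq_mean => s _; rewrite big_nil.
rewrite big_cons -IHr; case: ifP => p_i.
  by rewrite -meanD; apply: eq_mean => s _; rewrite big_cons p_i.
by apply: eq_mean => s _; rewrite big_cons p_i.
Qed.

Lemma mean_cat a b (f : seq bool -> R) :
  mean (a + b) f = mean a (fun s => mean b (fun t => f (s ++ t))).
Proof. by elim: a f => //= a IHa f; rewrite !IHa. Qed.

Lemma mean_swap a b (F : seq bool -> seq bool -> R) :
  mean a (fun s => mean b (F s)) = mean b (fun t => mean a (F^~ t)).
Proof.
elim: a F => //= a IHa F; rewrite !IHa -meanD mulrC -meanZ.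
by apply: eq_mean => s _; rewrite mulrC.
Qed.

Lemma mean_flip n (f : seq bool -> R) : mean n (fun s => f (map negb s)) = mean n f.
Proof.
elim: n f => //= n IHn f.
by rewrite (IHn (fun s => f (false :: s))) (IHn (fun s => f (true :: s))) addrC.
Qed.

Definition coin_sum s : int := \sum_(b <- s) (if b then 1 else -1).

Lemma coin_sum_cons b s :
  coin_sum (b :: s) = (if b then 1 else -1) + coin_sum s.
Proof. by rewrite /coin_sum big_cons. Qed.

Lemma coin_sum_cat s t : coin_sum (s ++ t) = coin_sum s + coin_sum t.
Proof. exact: big_cat. Qed.

Lemma coin_sum_flip s : coin_sum (map negb s) = - coin_sum s.
Proof.
by rewrite /coin_sum big_map -sumrN; apply: eq_bigr => -[] _ /=; rewrite ?opprK.
Qed.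

Lemma coin_sum_count s : coin_sum s = (count id s)%:Z *+ 2 - (size s)%:Z.
Proof.
elim: s => [|b s IHs]; first by rewrite /coin_sum big_nil.
by rewrite coin_sum_cons IHs /=; case: b => /=; lia.
Qed.

Lemma coin_sum_off_fold m i s :
  coin_sum (off_fold m i s) = coin_sum s - coin_sum (fold m i s).
Proof.
have s_split : s = take (i * m) s ++ fold m i s ++ drop (i.+1 * m) s.
  by rewrite /fold mulSn -drop_drop !cat_take_drop.
rewrite [X in coin_sum X - _]s_split /off_fold !coin_sum_cat; ring.
Qed.

Lemma mean_coin_sum2 n : mean n (fun s => (coin_sum s)%:~R ^+ 2) = n%:R.
Proof.
elim: n => [|n IHn] /=; first by rewrite /coin_sum big_nil expr0n.
transitivity (mean n (fun s => (coin_sum s)%:~R ^+ 2 + 1)).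
  rewrite -meanD -[LHS]mulrC -meanZ; apply: eq_mean => s _.
  by rewrite !coin_sum_cons !intrD; field.
by rewrite meanD mean_const IHn -natr1.
Qed.

(** With the second moment, this fourth moment bounds the first absolute moment
    from below. *)
Lemma mean_coin_sum4 n :
  mean n (fun s => (coin_sum s)%:~R ^+ 4) <= 3 * n%:R ^+ 2.
Proof.
suff -> : mean n (fun s => (coin_sum s)%:~R ^+ 4) = 3 * n%:R ^+ 2 - 2 * n%:R.
  by rewrite lerBlDr lerDl mulr_ge0.
elim: n => [|n IHn] /=; first by rewrite /coin_sum big_nil /=; ring.
transitivity (mean n (fun s => (coin_sum s)%:~R ^+ 4
                        + (6 * (coin_sum s)%:~R ^+ 2 + 1))).
  rewrite -meanD -[LHS]mulrC -meanZ; apply: eq_mean => s _.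
  by rewrite !coin_sum_cons !intrD; field.
rewrite meanD meanD meanZ mean_const mean_coin_sum2 IHn -natr1; ring.
Qed.

(** [|x|] dominates the quartic c2 x^2 + c4 x^4 that touches it at |x| = a:
    the difference is |x| (|x|/a - 1)^2 (|x|/a + 2) / 2.  With a of the order of
    the standard deviation the quartic has mean of that order too. *)
Lemma mean_abs_coin_sum n : Num.sqrt n%:R / 2 <= mean n (fun s => `|(coin_sum s)%:~R : R|).
Proof.
case: n => [|n]; first by rewrite sqrtr0 mul0r /= normr_ge0.
set m := n.+1; set r := Num.sqrt _.
have r_gt0 : 0 < r by rewrite sqrtr_gt0 ltr0n.
have r2 : r ^+ 2 = m%:R by rewrite /r sqr_sqrtr ?ler0n.
(* This choice of the contact point gives the constant 5/9 >= 1/2. *)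
pose a := (3 : R) / 2 * r.
have a_gt0 : 0 < a by rewrite /a mulr_gt0// divr_gt0// ltr0n.
pose c2 : R := 3 / 2 / a; pose c4 : R := - (a ^- 3 / 2).
apply: (@le_trans _ _ (mean m (fun s => c2 * (coin_sum s)%:~R ^+ 2
                                        + c4 * (coin_sum s)%:~R ^+ 4))).
  rewrite meanD !meanZ mean_coin_sum2.
  have c4_le : c4 * (3 * m%:R ^+ 2) <= c4 * mean m (fun s => (coin_sum s)%:~R ^+ 4).
    apply: ler_wnM2l; last exact: mean_coin_sum4.
    by rewrite oppr_le0 divr_ge0// invr_ge0 exprn_ge0// ltW.
  apply: le_trans (lerD (lexx _) c4_le); rewrite /c2 /c4 -r2 /a.
  have -> : 3 / 2 / (3 / 2 * r) * r ^+ 2 + - ((3 / 2 * r) ^- 3 / 2) * (3 * (r ^+ 2) ^+ 2)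
     = (5 / 9) * r :> R by field; rewrite gt_eqF.
  by rewrite mulrC ler_pM2r//; lra.
apply: le_mean => s _; set y := `|_|.
have y_ge0 : 0 <= y by apply: normr_ge0.
have -> : c2 * (coin_sum s)%:~R ^+ 2 + c4 * (coin_sum s)%:~R ^+ 4 =
   c2 * y ^+ 2 + c4 * y ^+ 4.
  by rewrite /y -!normrX !ger0_norm// exprn_even_ge0.
rewrite -subr_ge0.
have -> : y - (c2 * y ^+ 2 + c4 * y ^+ 4) =
   y * (y / a - 1) ^+ 2 * (y / a + 2) / 2.
  by rewrite /c2 /c4; field; rewrite gt_eqF.
have ya_ge0 : 0 <= y / a by rewrite divr_ge0// ltW.
by rewrite divr_ge0// mulr_ge0 ?addr_ge0// mulr_ge0 ?sqr_ge0.
Qed.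

Lemma mean_count n a :
  mean n (fun s => (count id s == a)%:R) = 'C(n, a)%:R / 2 ^+ n.
Proof.
elim: n a => [|n IHn] a /=; first by rewrite bin0n eq_sym expr0 divr1.
rewrite (IHn a); case: a => [|a].
  rewrite !bin0 (_ : mean n _ = 0) ?add0r ?exprS; last first.
    by rewrite -[RHS](mean_const n); apply: eq_mean.
  by field; rewrite expf_neq0 ?pnatr_eq0.
rewrite (_ : mean n _ = 'C(n, a)%:R / 2 ^+ n); last by rewrite -IHn; apply: eq_mean.
by rewrite binS natrD exprS; field; rewrite expf_neq0 ?pnatr_eq0.
Qed.

Lemma leq_bin_upper_half n a b : (n./2 <= a <= b)%N -> ('C(n, b) <= 'C(n, a))%N.
Proof.
case/andP=> n_a; elim: b => [|b IHb]; first by rewrite leqn0 => /eqP->.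
rewrite leq_eqVlt => /orP[/eqP<-//|ab]; apply: leq_trans (IHb _) => //.
rewrite -(leq_pmul2l (ltn0Sn b)) mul_bin_left leq_mul2r; apply/orP; right.
lia.
Qed.

Lemma sum_windows (v : nat -> nat) q M :
  (forall a b, (a <= b)%N -> (v b <= v a)%N) ->
  (\sum_(i < M * q) v i <= M * \sum_(i < q) v i)%N.
Proof.
move=> v_mono; elim: M => [|M IHM]; first by rewrite mul0n big_ord0.
rewrite mulSn addnC big_split_ord /= mulSn addnC leq_add //.
by apply: leq_sum => i _; apply: v_mono; rewrite leq_addl.
Qed.

Lemma mean_window n q :
  mean n (fun s => (n./2 <= count id s < n./2 + q)%N%:R) =
    (\sum_(i < q) 'C(n, n./2 + i))%N%:R / 2 ^+ n.
Proof.
rewrite natr_sum mulr_suml.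
under eq_bigr => i _ do rewrite -mean_count.
rewrite -mean_sum; apply: eq_mean => s _.
set c := count id s; have [/andP[c1 c2]|out] := boolP (_ && _).
  have lt_q : (c - n./2 < q)%N by lia.
  rewrite (bigD1 (Ordinal lt_q)) //= big1 ?addr0 => [|i /eqP i_neq].
    by rewrite subnKC ?eqxx.
  rewrite (_ : (c == _) = false)//; apply/eqP => ci; apply: i_neq.
  by apply/val_inj => /=; lia.
rewrite big1// => i _; rewrite (_ : (c == _) = false)//.
by apply/eqP => ci; case/negP: out; have := ltn_ord i; lia.
Qed.

(** A count or its complement under flipping is at least the half, so by symmetry
    the upper half has mass at least 1/2. *)
Lemma half_mean_count n : 1 / 2 <= mean n (fun s => (n./2 <= count id s)%N%:R).
Proof.
set e := mean _ _.
suff : 1 <= e + e by lra.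
rewrite -{2}[e]mean_flip -meanD -[leLHS](mean_const n).
apply: le_mean => s sz_s.
have : (count id s + count id (map negb s) = n)%N.
  by rewrite count_map -sz_s; exact: (count_predC id).
case: (leqP n./2 (count id s)) => //= h1 h2; first by rewrite lerDl.
by rewrite (_ : (n./2 <= _)%N) ?add0r//; lia.
Qed.

Lemma chebyshev_count n L : (0 < L)%N -> (n * 4 <= (L * 2 - 1) ^ 2)%N ->
  mean n (fun s => (n./2 + L <= count id s)%N%:R) <= 1 / 4.
Proof.
move=> L_gt0 nL; set l := (L * 2 - 1)%N in nL.
have l_gt0 : 0 < l%:R ^+ 2 :> R by rewrite exprn_gt0// ltr0n /l; lia.
apply: (@le_trans _ _ (mean n (fun s => l%:R ^- 2 * (coin_sum s)%:~R ^+ 2))).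
  apply: le_mean => s sz_s; case: leqP => [h|_] /=; last first.
    by rewrite mulr_ge0 ?sqr_ge0// invr_ge0 ltW.
  rewrite mulrC ler_pdivlMr// mul1r lerXn2r ?nnegrE//.
    by rewrite ler0z coin_sum_count sz_s; lia.
  by rewrite -[l%:R]/(l%:Z%:~R) ler_int coin_sum_count sz_s; lia.
rewrite meanZ mean_coin_sum2 mulrC ler_pdivrMr//.
have : (n * 4)%:R <= (l ^ 2)%:R :> R by rewrite ler_nat.
by rewrite natrM natrX; lra.
Qed.

(** A window of q counts starting at the centre captures a 1/(4M) share.  The M
    windows above the centre hold mass 1/2 minus the tail, which Chebyshev's
    inequality bounds by 1/4 when M q exceeds sqrt n, and by unimodality of the
    binomial coefficients the central window is the heaviest. *)
Lemma mean_window_ge n q M : (0 < q)%N -> (0 < M)%N ->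
  (n * 4 <= (M * q * 2 - 1) ^ 2)%N ->
  1 / 4 <= M%:R * mean n (fun s => (n./2 <= count id s < n./2 + q)%N%:R).
Proof.
move=> q_gt0 M_gt0 nL.
rewrite mean_window mulrA -natrM.
apply: (@le_trans _ _ (mean n (fun s => (n./2 <= count id s < n./2 + M * q)%N%:R))).
  have -> : 1 / 4 = 1 / 2 - 1 / 4 :> R by field.
  have := lerB (half_mean_count n) (chebyshev_count _ nL).
  rewrite muln_gt0 M_gt0 q_gt0 => /(_ isT) /le_trans; apply.
  rewrite -mulN1r -meanZ -meanD; apply: le_mean => s _.
  case: (leqP n./2) => h1; case: (leqP (_ + M * q)) => h2 /=; rewrite ?subrr; lra.
rewrite mean_window ler_pM2r ?invr_gt0 ?exprn_gt0// ler_nat.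
apply: (@sum_windows (fun i => 'C(n, n./2 + i))) => a b ab.
by apply: leq_bin_upper_half; lia.
Qed.

(** The mean vote of a majority rule on a sample of sign sum [u]: [tau] is its
    mean vote on a tie. *)
Definition tie_sign (tau : R) (u : int) : R :=
  if 0 < u then 1 else if u < 0 then -1 else tau.

(** For |u| < |x| the four signs add up and give 4|x|; for |u| > |x| everything
    cancels.  For |u| = |x| > 0 exactly two of the four signs are ties, and they
    enter with opposite coefficients: symmetrizing in u makes the unknown [tau]
    cancel, leaving exactly 2|x|. *)
Lemma tie_sign_symm_ge (tau : R) (u x : int) : -1 <= tau <= 1 ->
  2 * (((`|u| <= `|x|)%R)%:R * `|x|%:~R) <=
  (tie_sign tau (u + x) - tie_sign tau (u - x) + tie_sign tau (- u + x)
     - tie_sign tau (- u - x)) * x%:~R.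
Proof.
move=> t1; wlog x_ge0 : x / 0 <= x => [hw|].
  have [/hw//|x_lt0] := leP 0 x.
  have := hw (- x); rewrite oppr_ge0 (ltW x_lt0) normrN !opprK => /(_ isT) /le_trans.
  have E (a b c d y : R) : (a - b + c - d) * - y = (b - a + d - c) * y by ring.
  by apply; rewrite mulrNz E.
wlog u_ge0 : u / 0 <= u => [hw|].
  have [/hw//|u_lt0] := leP 0 u.
  have := hw (- u); rewrite oppr_ge0 (ltW u_lt0) normrN !opprK => /(_ isT) /le_trans.
  have E (a b c d : R) : a - b + c - d = c - d + a - b by ring.
  by apply; rewrite E.
rewrite !ger0_norm//.
have x_ge0R : 0 <= x%:~R :> R by rewrite ler0z.
have pos v : 0 < v -> tie_sign tau v = 1 by rewrite /tie_sign => ->.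
have neg v : v < 0 -> tie_sign tau v = -1.
  by rewrite /tie_sign => v_lt0; rewrite v_lt0 (lt_gtF v_lt0).
have [ux|xu|ux] := ltgtP u x.
- rewrite (pos (u + x)) ?(neg (u - x)) ?(pos (- u + x)) ?(neg (- u - x)); try lia.
  by rewrite mul1r; lra.
- rewrite (pos (u + x)) ?(pos (u - x)) ?(neg (- u + x)) ?(neg (- u - x)); try lia.
  by rewrite mul0r; lra.
rewrite ux subrr addNr; have [x_gt0|x_le0] := ltP 0 x.
  rewrite (pos (x + x)) ?(neg (- x - x)); try lia.
  by rewrite mul1r; lra.
have -> : x = 0 by lia.
by rewrite mulr0z !mulr0.
Qed.

(** Each of two distinct folds is part of the training sample of the other.
    Given the sum [u] of the remaining folds, the mean of the product of their
    contributions is the square of this number. *)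
Definition fold_gain (tau : R) m (u : int) : R :=
  mean m (fun f => tie_sign tau (u + coin_sum f) * (coin_sum f)%:~R).

(** Averaging over the flip of the fold replaces the sign by the differences in
    [tie_sign_symm_ge], so the sum is at least the mean of |F| 1{|F| >= |u|},
    which is at least the mean of |F| - 2q.  The bound 1 inside the maximum
    allows |u| = 1 even if q = 0: then |F| < |u| forces F = 0.  This keeps the
    lemma meaningful for folds of size one and an odd number of flips. *)
Lemma fold_gain_ge (tau : R) m q (u : int) : -1 <= tau <= 1 ->
  `|u| <= Num.max 1 (2 * q)%:Z ->
  Num.sqrt m%:R / 2 - (2 * q)%:R <= fold_gain tau m u + fold_gain tau m (- u).
Proof.
move=> t1 u_le.
have sym v : fold_gain tau m v = 1 / 2 *
    mean m (fun f => (tie_sign tau (v + coin_sum f) - tie_sign tau (v - coin_sum f))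
                       * (coin_sum f)%:~R).
  have -> : fold_gain tau m v = 1 / 2 * (fold_gain tau m v + fold_gain tau m v) by field.
  rewrite {2}/fold_gain -mean_flip -meanD; congr (_ * _); apply: eq_mean => s _.
  by rewrite coin_sum_flip mulrNz; ring.
rewrite !sym -mulrDr -meanD -meanZ.
apply: le_trans (lerD (mean_abs_coin_sum m) (lexx _)) _.
rewrite -(mean_const m (- ((2 * q)%:R))) -meanD; apply: le_mean => s _.
set x := coin_sum s.
apply: (@le_trans _ _ (1 / 2 * (2 * (((`|u| <= `|x|)%R)%:R * `|x|%:~R)))); last first.
  rewrite ler_pM2l ?divr_gt0//; apply: le_trans (tie_sign_symm_ge _ _ t1) _.
  by rewrite le_eqVlt; apply/orP; left; apply/eqP; ring.
have q_ge0 : 0 <= (2 * q)%:R :> R by [].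
rewrite -intr_norm; have [ux|xu] := leP `|u| `|x|.
  by rewrite !mul1r; lra.
rewrite mul0r !mulr0 subr_le0 -[(2 * q)%:R]/((2 * q)%N%:Z%:~R) ler_int.
by move: u_le; rewrite le_max => /orP[u1|uq]; lia.
Qed.

(** Cut the sequence into five blocks around folds [i] and [j]; the three outer
    blocks enter only through their sum and merge into one block of (k-2)m
    flips. *)
Lemma mean_fold_pair (Phi : int -> int -> int -> R) k m i j : (i < j < k)%N ->
  mean (k * m) (fun s => Phi (coin_sum s) (coin_sum (fold m i s))
                              (coin_sum (fold m j s))) =
  mean ((k - 2) * m) (fun u => mean m (fun f => mean m (fun f' =>
    Phi (coin_sum u + coin_sum f + coin_sum f') (coin_sum f) (coin_sum f')))).
Proof.
case/andP=> ij jk.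
have [b def_j] : exists b, j = (i + b.+1)%N by exists (j - i.+1)%N; lia.
have [c def_k] : exists c, k = (j + c.+1)%N by exists (k - j.+1)%N; lia.
have -> : (k * m = i * m + (m + (b * m + (m + c * m))))%N.
  by rewrite def_k def_j !(mulnDl, mulSn); lia.
have -> : ((k - 2) * m = i * m + (b * m + c * m))%N.
  by rewrite -!mulnDl; congr (_ * _)%N; lia.
rewrite !mean_cat; apply: eq_mean => s1 sz1; rewrite mean_cat.
transitivity (mean m (fun f => mean (b * m) (fun s2 => mean m (fun f' =>
    mean (c * m) (fun s3 =>
      Phi (coin_sum (s1 ++ (s2 ++ s3)) + coin_sum f + coin_sum f')
        (coin_sum f) (coin_sum f')))))).
  rewrite /fold; apply: eq_mean => f szf; rewrite mean_cat; apply: eq_mean => s2 sz2.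
  rewrite mean_cat; apply: eq_mean => f' szf'; apply: eq_mean => s3 sz3.
  rewrite -sz1 drop_size_cat// take_size_cat//.
  have -> : (j * m = size (s1 ++ f ++ s2))%N by rewrite !size_cat sz1 sz2 szf def_j mulnDl mulSn; lia.
  rewrite (_ : s1 ++ f ++ s2 ++ f' ++ s3 = (s1 ++ f ++ s2) ++ f' ++ s3) ?catA//.
  rewrite -catA drop_size_cat// take_size_cat// !coin_sum_cat; congr Phi; ring.
rewrite mean_swap [RHS]mean_cat; apply: eq_mean => s2 _.
by rewrite [RHS]mean_swap; apply: eq_mean => f _; apply: mean_swap.
Qed.

(** The integer ceiling of sqrt (n / c), described without square roots. *)
Lemma exists_sqrt_ceil c n : (0 < c)%N -> (0 < n)%N ->
  exists q, [/\ (0 < q)%N, (n <= c * q ^ 2)%N & (c * q.-1 ^ 2 <= n)%N].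
Proof.
move=> c_gt0 n_gt0; have ex : exists q, (n <= c * q ^ 2)%N by exists n; nia.
have [q nq q_min] := ex_minnP ex; exists q.
have q_gt0 : (0 < q)%N by case: q nq {q_min} => //; lia.
split=> //; rewrite leqNgt; apply/negP => n_lt.
by have := q_min q.-1 (ltnW n_lt); lia.
Qed.

(** The small-ball estimate meets the gain estimate: q is about sqrt m / 8, so
    that the gain is of order sqrt m on the central window of q counts, and
    M = 16 r with r about sqrt k is the number of such windows needed to cover a
    constant share of the mass. *)
Lemma mean_fold_gain_sq (tau : R) k m : -1 <= tau <= 1 -> (2 <= k)%N -> (0 < m)%N ->
  m%:R <= 2 * 64 ^+ 2 * Num.sqrt k%:R *
    mean ((k - 2) * m) (fun u => fold_gain tau m (coin_sum u) ^+ 2).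
Proof.
move=> tau1 k_ge2 m_gt0; set n := ((k - 2) * m)%N; set G := mean n _.
(* The factor 64 makes 2 (q - 1) <= sqrt m / 4, half of the lower bound on the
   mean of |F|. *)
have [q [q_gt0 m_q q_m]] := @exists_sqrt_ceil 64 m isT m_gt0.
have [r [r_gt0 k_r r_k]] := @exists_sqrt_ceil 1 k isT (ltnW k_ge2).
rewrite !mul1n in k_r r_k.
have nM : (n * 4 <= (16 * r * q * 2 - 1) ^ 2)%N.
  have rq_gt0 : (0 < r * q)%N by rewrite muln_gt0 r_gt0.
  have km : (k * m <= r ^ 2 * (64 * q ^ 2))%N by apply: leq_mul.
  have nkm : (n <= k * m)%N by rewrite leq_mul2r leq_subr orbT.
  apply: (@leq_trans ((31 * (r * q)) ^ 2)); last by rewrite leq_sqr; nia.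
  move: (leq_trans nkm km); rewrite !expnMn; lia.
have M_gt0 : (0 < 16 * r)%N by rewrite muln_gt0.
have : 1 / 4 <= _ :> R := mean_window_ge q_gt0 M_gt0 nM; set w := mean n _ => w_ge.
have sqm : Num.sqrt m%:R ^+ 2 = m%:R :> R by rewrite sqr_sqrtr.
have q_le : (8 * q.-1)%:R <= Num.sqrt m%:R :> R.
  rewrite -[leLHS]ger0_norm// -sqrtr_sqr ler_sqrt// -natrX ler_nat.
  by rewrite expnMn.
have G_ge : m%:R / 64 * w <= G.
  have -> : G = 1 / 2 * (G + G) by field.
  rewrite {2}/G -mean_flip -meanD -!meanZ; apply: le_mean => u sz_u.
  rewrite coin_sum_flip; have [/andP[u1 u2]|_] := boolP (_ && _); last first.
    by rewrite mulr0 mulr_ge0 ?divr_ge0// addr_ge0 ?sqr_ge0.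
  (* A count exceeding n./2 by at most q - 1 has a sign sum of absolute value at
     most 2 (q - 1), or 1 when n is odd and the excess is 0. *)
  have := fold_gain_ge m (q:=q.-1) (u:=coin_sum u) tau1.
  have -> : `|coin_sum u| <= Num.max 1 (2 * q.-1)%:Z.
    by rewrite le_max coin_sum_count sz_u; lia.
  move/(_ isT); set g1 := fold_gain _ _ _; set g2 := fold_gain _ _ _ => g12.
  have {}g12 : Num.sqrt m%:R / 4 <= g1 + g2.
    apply: le_trans g12; move: q_le; rewrite !natrM; lra.
  have : (Num.sqrt m%:R / 4) ^+ 2 <= (g1 + g2) ^+ 2.
    by rewrite lerXn2r ?nnegrE ?divr_ge0 ?sqrtr_ge0//
         (le_trans _ g12)// divr_ge0 ?sqrtr_ge0.
  rewrite expr_div_n sqm [true%:R]/=.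
  have := sqr_ge0 (g1 - g2).
  rewrite mulr1; nra.
have r_le : r%:R <= 2 * Num.sqrt k%:R :> R.
  rewrite -[leLHS]ger0_norm// -sqrtr_sqr -[2]ger0_norm// -sqrtr_sqr.
  rewrite -sqrtrM ?sqr_ge0// ler_sqrt ?mulr_ge0 ?sqr_ge0//.
  rewrite -!natrX -natrM ler_nat -(prednK r_gt0).
  move: (r.-1) r_k => p p_k; rewrite -[p.+1]add1n sqrnD; have [] := nat_Cauchy 1 p; lia.
apply: le_trans (_ : 64 ^+ 2 * r%:R * G <= _); last first.
  rewrite ler_wpM2r//; last lra.
  by rewrite /G -(mean_const n 0); apply: le_mean => u _; rewrite sqr_ge0.
have r0 : 0 < r%:R :> R by rewrite ltr0n.
rewrite natrM in w_ge.
apply: le_trans (ler_wpM2l _ G_ge); last by rewrite mulr_ge0 ?exprn_ge0.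
have m0 : 0 <= m%:R :> R by [].
have := ler_wpM2l m0 w_ge; nra.
Qed.

(** For the majority rule on fair-coin labels, this is - 2n times the deviation
    from 1/2 of the cross-validation estimate, averaged over the ties. *)
Definition majority_cv_sum (tau : R) k m s : R :=
  \sum_(i < k) tie_sign tau (coin_sum (off_fold m i s)) * (coin_sum (fold m i s))%:~R.

(** Given the common part u, the product regroups as
    sg(u + F_j) F_j . sg(u + F_i) F_i, a product of independent factors. *)
Lemma mean_majority_cv_cross (tau : R) k m i j : (i < j < k)%N ->
  mean (k * m) (fun s =>
     (tie_sign tau (coin_sum (off_fold m i s)) * (coin_sum (fold m i s))%:~R)
   * (tie_sign tau (coin_sum (off_fold m j s)) * (coin_sum (fold m j s))%:~R)) =
  mean ((k - 2) * m) (fun u => fold_gain tau m (coin_sum u) ^+ 2).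
Proof.
move=> ijk.
pose Phi (a b c : int) := (tie_sign tau (a - b) * b%:~R)
                        * (tie_sign tau (a - c) * c%:~R).
transitivity (mean (k * m) (fun s =>
    Phi (coin_sum s) (coin_sum (fold m i s)) (coin_sum (fold m j s)))).
  by apply: eq_mean => s _; rewrite /Phi !coin_sum_off_fold.
rewrite (mean_fold_pair Phi) //; apply: eq_mean => u _.
rewrite expr2 {2}/fold_gain -meanZ; apply: eq_mean => f _.
rewrite mulrC /fold_gain -meanZ; apply: eq_mean => f' _.
move: (coin_sum u) (coin_sum f) (coin_sum f') => a b c; rewrite /Phi.
have -> : a + b + c - b = a + c by ring.
have -> : a + b + c - c = a + b by ring.
by move: (tie_sign _ (a + c)) (tie_sign _ (a + b)) => x y; ring.
Qed.

(** The diagonal terms of the square are nonnegative and the k(k-1) others are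
    all equal. *)
Lemma mean_majority_cv_sum_sq (tau : R) k m : -1 <= tau <= 1 -> (2 <= k)%N -> (0 < m)%N ->
  (k * m)%:R * Num.sqrt k%:R / 128 ^+ 2 <= mean (k * m) (fun s => majority_cv_sum tau k m s ^+ 2).
Proof.
move=> tau1 k_ge2 m_gt0.
have := mean_fold_gain_sq tau1 k_ge2 m_gt0.
set G := mean _ _ => G_ge.
pose a (i : 'I_k) s := tie_sign tau (coin_sum (off_fold m i s)) * (coin_sum (fold m i s))%:~R.
have -> : mean (k * m) (fun s => majority_cv_sum tau k m s ^+ 2) =
  \sum_i \sum_j mean (k * m) (fun s => a i s * a j s).
  under eq_bigr => i _ do rewrite -mean_sum.
  rewrite -mean_sum; apply: eq_mean => s _; rewrite expr2 /majority_cv_sum mulr_suml.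
  by apply: eq_bigr => i _; rewrite mulr_sumr.
have cross i j : i != j -> mean (k * m) (fun s => a i s * a j s) = G.
  move=> ij; have : (i < j)%N || (j < i)%N by rewrite -neq_ltn.
  case/orP => lt_ij; first by apply: mean_majority_cv_cross; rewrite lt_ij ltn_ord.
  transitivity (mean (k * m) (fun s => a j s * a i s)).
    by apply: eq_mean => s _; rewrite mulrC.
  by apply: mean_majority_cv_cross; rewrite lt_ij ltn_ord.
apply: (@le_trans _ _ (\sum_(i < k) (k.-1)%:R * G)); last first.
  apply: ler_sum => i _; rewrite (bigD1 i)//= ler_wpDl//.
    rewrite -(mean_const (k * m) 0); apply: le_mean => s _.
    by rewrite -expr2 sqr_ge0.
  rewrite (eq_bigr (fun=> G)) => [|j ji]; last by rewrite cross// eq_sym.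
  rewrite sumr_const mulr_natl.
  by rewrite (_ : #|_| = k.-1)// cardC1 card_ord.
rewrite sumr_const card_ord -[leRHS]mulr_natl natrM.
set r := Num.sqrt _ in G_ge *.
have r_ge0 : 0 <= r by apply: sqrtr_ge0.
have r2 : r ^+ 2 = k%:R by rewrite sqr_sqrtr.
have G_ge0 : 0 <= G.
  by rewrite /G -(mean_const ((k - 2) * m) 0); apply: le_mean => u _; rewrite sqr_ge0.
have k1 : k%:R / 2 <= (k.-1)%:R :> R.
  by rewrite ler_pdivrMr// -natrM ler_nat; clear -k_ge2; lia.
apply: (@le_trans _ _ (k%:R * (k%:R / 2 * G))); last first.
  by rewrite ler_wpM2l// ler_wpM2r.
rewrite -!mulrA ler_wpM2l//.
have := ler_wpM2r r_ge0 G_ge.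
rewrite -r2; nra.
Qed.

End FairCoins.

(** * Square-integral bounds and coordinates of i.i.d. samples *)

Section Moments.
Context d (T : measurableType d) (R : realType) (P : probability T R).

(** Jensen's inequality for the square, from the tangent f^2 >= 2 a f - a^2. *)
Lemma sqr_integral_le (f : T -> R) (a C : R) :
  measurable_fun setT f -> (forall x, `|f x| <= C) ->
  (\int[P]_x (f x)%:E = a%:E)%E -> ((a ^+ 2)%:E <= \int[P]_x (f x ^+ 2)%:E)%E.
Proof.
move=> mf f_le fa.
have Pfin : (P [set: T] < +oo)%E by rewrite probability_setT ltry.
have bnd (g : T -> R) : measurable_fun setT g ->
    (exists M, forall x, `|g x| <= M) -> P.-integrable setT (EFin \o g).
  move=> mg [M gM]; apply: measurable_bounded_integrable => //.
  exists M; split; first exact: num_real.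
  by move=> N MN x _; apply: le_trans (ltW MN).
have fi : P.-integrable setT (EFin \o f) by apply: bnd => //; exists C.
have fi2 : P.-integrable setT (EFin \o (fun x => f x ^+ 2)).
  apply: bnd; first exact: (measurable_funM mf mf).
  exists (C ^+ 2) => x; rewrite normrX lerXn2r ?nnegrE//.
  exact: le_trans (f_le x).
have ci : P.-integrable setT (EFin \o cst (- a ^+ 2)).
  by apply: bnd => //; exists `|- a ^+ 2|.
have lini : P.-integrable setT (fun x => (2 * a)%:E * (EFin \o f) x)%E.
  exact: integrableZl.
have <- : (\int[P]_x ((2 * a)%:E * (EFin \o f) x + (EFin \o cst (- a ^+ 2)%R) x) = (a ^+ 2)%:E)%E.
  rewrite integralD// integralZl// fa /= integral_cst// [X in (_ + _ * X)%E](probability_setT P) mule1.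
  by rewrite -EFinM -EFinD; congr (_%:E); ring.
apply: le_integral => //; first exact: integrableD.
move=> x _ /=; rewrite -EFinM -EFinD lee_fin.
have := sqr_ge0 (f x - a); lra.
Qed.

Lemma integral_sign_sum k (c : 'I_k -> R) (E : 'I_k -> set T) :
  (forall i, measurable (E i)) ->
  (\int[P]_x (\sum_i c i * (2 * \1_(E i) x - 1))%:E =
   (\sum_i c i * (2 * fine (P (E i)) - 1))%:E)%E.
Proof.
move=> mE.
have int_i i : P.-integrable setT (fun x => (2 * c i)%:E * (\1_(E i) x)%:E)%E.
  apply: integrableZl => //; apply: integrable_indic => //.
have int_c (r : R) : P.-integrable setT (fun=> r%:E).
  exact: finite_measure_integrable_cst.
transitivity (\int[P]_x \sum_i ((2 * c i)%:E * (\1_(E i) x)%:E + (- c i)%:E))%E.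
  apply: eq_integral => x _; rewrite -sumEFin; apply: eq_bigr => i _.
  by rewrite -EFinM -EFinD; congr (_%:E); ring.
rewrite integral_sum//; last by move=> i; apply: integrableD.
rewrite -sumEFin; apply: eq_bigr => i _.
rewrite integralD// integralZl//; last first.
  by apply: integrable_indic.
rewrite integral_indic// setIT integral_cst// [X in (_ + _ * X)%E](probability_setT P) mule1.
rewrite -[X in (_ * X + _)%E]fineK ?fin_num_measure//.
by rewrite -EFinM -EFinD; congr (_%:E); ring.
Qed.

End Moments.

Section Sample.
Context d (T : measurableType d) (R : realType) (P : probability T R).

Lemma iid_tnth n (i : 'I_n) (B : set T) : measurable B ->
  iid P n [set t | B (tnth t i)] = P B.
Proof.
elim: n i => [[]//|n IHn] i mB /=.
rewrite /distribution /pushforward.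
have [j ->|->] := unliftP ord0 i.
  rewrite (_ : _ @^-1` _ = setT `*` [set t : n.-tuple T | B (tnth t j)]); last first.
    by apply/seteqP; split=> -[a t] /=; rewrite tnthS => // -[].
  have mBj : measurable [set t : n.-tuple T | B (tnth t j)].
    by have := @measurable_tnth _ T n j measurableT B mB; rewrite setTI.
  by rewrite product_measure1E// [X in (X * _)%E](probability_setT P) mul1e; apply: IHn.
rewrite (_ : _ @^-1` _ = B `*` setT); last first.
  by apply/seteqP; split=> -[a t] //= -[].
by rewrite product_measure1E// [X in (_ * X)%E](probability_setT (iid P n)) mule1.
Qed.

End Sample.

(** * Samples with fair-coin labels *)

Section CoinLaw.
Context d (T : measurableType d) (R : realType).

(** A named copy of the function, to which a structure of measurable function
    can be attached. *)
Definition coin_map (z : bool -> T) : bool -> T := z.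

Lemma measurable_coin_map z : measurable_fun setT (coin_map z).
Proof. by []. Qed.

HB.instance Definition _ z :=
  isMeasurableFun.Build _ _ _ _ (coin_map z) (measurable_coin_map z).

Definition coin_law (z : bool -> T) : probability T R :=
  distribution (bernoulli_prob 2^-1) (coin_map z).

Let half01 : 0 <= (2^-1 : R) <= 1. Proof. lra. Qed.

Lemma integral_coin_law z (f : T -> \bar R) :
  measurable_fun setT f -> (forall t, 0 <= f t)%E ->
  (\int[coin_law z]_t f t = 2^-1%:E * f (z true) + 2^-1%:E * f (z false))%E.
Proof.
move=> mf f_ge0; rewrite ge0_integral_distribution// integral_bernoulli_prob//=.
by rewrite (_ : unstable.onem 2^-1 = 2^-1 :> R)// /unstable.onem; field.
Qed.

Lemma coin_law_pred z (Q : pred T) :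
  fine (coin_law z [set t | Q t]) = ((Q (z true))%:R + (Q (z false))%:R) / 2.
Proof.
rewrite /coin_law /= /distribution /pushforward bernoulli_probE// !diracE.
rewrite (_ : unstable.onem 2^-1 = 2^-1 :> R); last by rewrite /unstable.onem; field.
have inQ b : (b \in coin_map z @^-1` [set t | Q t]) = Q (z b).
  by apply/idP/idP; rewrite inE.
rewrite !inQ.
by rewrite -!EFinM -EFinD /=; field.
Qed.

(** The law of the sample is carried by the 2^n sequences of values of [z], so a
    bound at these points suffices. *)
Lemma le_integral_iid_coin z n (G : n.-tuple T -> \bar R) (g : seq bool -> R) :
  measurable_fun setT G -> (forall t, 0 <= G t)%E ->
  (forall b : n.-tuple bool, (g b)%:E <= G [tuple of map z b])%E ->
  ((mean n g)%:E <= \int[iid (coin_law z) n]_t G t)%E.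
Proof.
elim: n G g => [|n IHn] G g mG G_ge0 gG /=.
  rewrite integral_dirac// diracT mul1e.
  by have := gG [tuple]; congr (_ <= G _)%E; apply/val_inj.
have mG1 : measurable_fun setT (G \o @tcons _ T n).
  by apply: measurableT_comp => //; exact: measurable_tcons.
rewrite ge0_integral_distribution// fubini_tonelli1//; last by move=> ?; apply: G_ge0.
have mG' a : measurable_fun setT (fun t : n.-tuple T => G [tuple of a :: t]).
  apply: measurableT_comp => //.
  exact: (@measurable_cons _ _ _ _ (cst a) n id).
have step b0 : ((mean n (fun s => g (b0 :: s)))%:E <=
    \int[iid (coin_law z) n]_t G [tuple of z b0 :: t])%E.
  apply: IHn => // b; have := gG [tuple of b0 :: b].
  by congr (_ <= G _)%E; apply/val_inj.
rewrite integral_coin_law//; last first.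
- by move=> t; apply: integral_ge0 => s _; apply: G_ge0.
- by apply: measurable_fun_fubini_tonelli_F => // ?; apply: G_ge0.
rewrite /fubini_F /= mulrDl EFinD ![_ * 2^-1]mulrC !EFinM.
by apply: leeD; apply: lee_wpmul2l; rewrite ?lee_fin ?invr_ge0//; exact: step.
Qed.

End CoinLaw.

(** * Measurability of the cross-validation error *)

Lemma fold_map (T U : Type) (f : T -> U) m i s :
  fold m i (map f s) = map f (fold m i s).
Proof. by rewrite /fold -map_drop -map_take. Qed.

Lemma off_fold_map (T U : Type) (f : T -> U) m i s :
  off_fold m i (map f s) = map f (off_fold m i s).
Proof. by rewrite /off_fold -map_drop -map_take -map_cat. Qed.

Section Measurability.
Context dX dY dW (X : measurableType dX) (Y : measurableType dY)
  (W : measurableType dW) (R : realType).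
Hypothesis diag_meas : measurable [set p : Y * Y | p.1 = p.2].

(** Points are sections of the diagonal. *)
Lemma measurable_singleton (y : Y) : measurable [set y].
Proof.
have mp : measurable_fun setT (fun y' : Y => (y', y)).
  exact: measurable_fun_pair.
have := mp measurableT _ diag_meas; rewrite setTI.
by congr measurable; apply/seteqP; split.
Qed.

Lemma measurable_loss d (T : measurableType d) (f g : T -> Y) :
  measurable_fun setT f -> measurable_fun setT g ->
  measurable_fun setT (fun t => (f t != g t)%:R : R).
Proof.
move=> mf mg; have mfg := measurable_fun_pair mf mg.
have mE : measurable [set t | f t = g t].
  by have := mfg measurableT _ diag_meas; rewrite setTI.
rewrite (_ : (fun t => _) = (fun t => 1 - \1_[set t | f t = g t] t)).
  apply: measurable_funB => //; exact: measurable_indic.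
apply/funext => t; rewrite indicE; have [fg|/eqP fg] := eqVneq (f t) (g t).
  by rewrite mem_set// subrr.
by rewrite memNset// subr0.
Qed.

Variable A : seq (X * Y) -> W -> X -> Y.
Hypothesis A_meas : jointly_measurable A.

(** A training sample is described by the list [idx] of positions it takes from
    the full sample, which makes its selection a measurable map between spaces
    of tuples. *)
Lemma measurable_predict d (T : measurableType d) n (S : T -> n.-tuple (X * Y)%type)
    (w : T -> W) (x : T -> X) (idx : seq 'I_n) :
  measurable_fun setT S -> measurable_fun setT w -> measurable_fun setT x ->
  measurable_fun setT (fun t => A (map (tnth (S t)) idx) (w t) (x t)).
Proof.
move=> mS mw mx.
pose St t := map_tuple (tnth (S t)) (in_tuple idx).
have mSt : measurable_fun setT St.
  apply/measurable_fun_tnthP => i.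
  rewrite (_ : _ \o _ = fun t => tnth (S t) (tnth (in_tuple idx) i)); last first.
    by apply/funext => t /=; rewrite tnth_map.
  apply: (measurableT_comp (measurable_tnth _)) => //.
have := measurableT_comp (@A_meas (size idx))
  (measurable_fun_pair mSt (measurable_fun_pair mw mx)).
by [].
Qed.

Lemma measurable_emp_err d (T : measurableType d) n (S : T -> n.-tuple (X * Y)%type)
    (w : T -> W) (idx1 idx2 : seq 'I_n) :
  measurable_fun setT S -> measurable_fun setT w ->
  measurable_fun setT (fun t =>
    emp_err R (A (map (tnth (S t)) idx1) (w t)) (map (tnth (S t)) idx2)).
Proof.
move=> mS mw; rewrite /emp_err.
under eq_fun => t do rewrite big_map size_map.
apply: measurable_funM => //; apply: measurable_sum => j.
have mSj : measurable_fun setT (fun t => tnth (S t) j).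
  exact: (measurableT_comp (measurable_tnth _)).
apply: measurable_loss; last exact: (measurableT_comp measurable_snd).
by apply: measurable_predict => //; exact: (measurableT_comp measurable_fst).
Qed.

Lemma measurable_cv_error n k (z : bool -> X * Y) :
  measurable_fun setT (fun q : n.-tuple (X * Y)%type * (W * k.-tuple W) =>
    cv_estimate R A q.1 q.2.2 - true_err (coin_law R z) (A q.1 q.2.1)).
Proof.
have S_idx (S : n.-tuple (X * Y)%type) : tval S = map (tnth S) (enum 'I_n).
  by rewrite map_tnth_enum.
apply: measurable_funB.
  rewrite /cv_estimate; apply: measurable_funM => //.
  apply: measurable_sum => i.
  under eq_fun => q do rewrite [tval _]S_idx fold_map off_fold_map.
  apply: measurable_emp_err => //.
  by apply: (measurableT_comp (measurable_tnth _)); apply: measurableT_comp.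
rewrite /true_err; under eq_fun => q.
  rewrite (coin_law_pred R z (fun t => A q.1 q.2.1 t.1 != t.2)) [tval _]S_idx.
  over.
apply: measurable_funM => //.
have mq : measurable_fun setT (fun q : n.-tuple (X * Y)%type * (W * k.-tuple W) => q.2.1).
  exact: measurableT_comp.
by apply: measurable_funD; apply: measurable_loss => //; apply: measurable_predict.
Qed.

End Measurability.

(** * Empirical risk minimization on two labels *)

Lemma size_fold T k m i (s : seq T) : (i < k)%N -> size s = (k * m)%N ->
  size (fold m i s) = m.
Proof.
move=> ik sz; rewrite /fold size_take size_drop sz.
have : (i.+1 * m <= k * m)%N by rewrite leq_mul2r ik orbT.
by rewrite mulSn; case: ltnP; lia.
Qed.

Lemma size_off_fold T k m i (s : seq T) : (i < k)%N -> size s = (k * m)%N ->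
  size (off_fold m i s) = (k.-1 * m)%N.
Proof.
move=> ik sz; rewrite /off_fold size_cat size_take size_drop sz.
have : (i.+1 * m <= k * m)%N by rewrite leq_mul2r ik orbT.
case: k ik sz => // k ik sz; rewrite !mulSn /=; case: ltnP; lia.
Qed.

(** Size and sign sum determine the number of heads, hence the sequence up to
    order. *)
Lemma perm_eq_coins s t : size s = size t -> coin_sum s = coin_sum t -> perm_eq s t.
Proof.
move=> szst; rewrite !coin_sum_count szst => cst.
have ct : count id s = count id t by lia.
apply/permP => p.
have cnt (u : seq bool) : count p u =
    (p true * count id u + p false * (size u - count id u))%N.
  elim: u => [|b u IHu] /=; first by rewrite !muln0.
  by rewrite IHu; have := count_size id u; case: b => /=; case: (p true); case: (p false); lia.
by rewrite !cnt ct szst.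
Qed.

Lemma half_pm_lt1 (R : realFieldType) (e : R) : 1 <= 2^-1 - e -> 1 <= 2^-1 + e -> False.
Proof. lra. Qed.

Lemma sign_mean_bound (R : realFieldType) (p : R) : 0 <= p <= 1 -> -1 <= 2 * p - 1 <= 1.
Proof. lra. Qed.

Section TwoLabels.
Context dX dY dW (X : measurableType dX) (Y : measurableType dY)
  (W : measurableType dW) (R : realType).
Hypothesis diag_meas : measurable [set p : Y * Y | p.1 = p.2].
Variables (H : set (X -> Y)) (P : probability W R) (A : seq (X * Y) -> W -> X -> Y).
Hypotheses (A_rule : learning_rule H P A) (A_ERM : is_ERM R H A).
Variables (h1 h2 : X -> Y) (x : X).
Hypotheses (Hh1 : H h1) (Hh2 : H h2) (h12 : h1 x <> h2 x).

Definition coin_example (b : bool) : X * Y := (x, if b then h1 x else h2 x).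
Local Notation z := coin_example.

Definition vote (h : X -> Y) : R := if h x == h1 x then 1 else -1.

Lemma labels_neqE : (h2 x == h1 x) = false. Proof. by apply/eqP => /esym. Qed.

(** Answering [h1 x] errs on the tails and answering [h2 x] on the heads. *)
Lemma emp_err_vote h s : h x = h1 x \/ h x = h2 x -> s != [::] ->
  emp_err R h (map z s) = 1 / 2 - vote h * (coin_sum s)%:~R / (2 * (size s)%:R).
Proof.
move=> hx s_neq0; rewrite /emp_err size_map big_map.
have -> : \sum_(b <- s) (h (z b).1 != (z b).2)%:R =
    ((size s)%:R - vote h * (coin_sum s)%:~R) / 2 :> R.
  elim: s {s_neq0} => [|b s IHs].
    by rewrite /coin_sum !big_nil mulr0 subr0 mul0r.
  rewrite big_cons IHs coin_sum_cons /= /vote -natr1 intrD.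
  have [->|->] := hx; first by rewrite eqxx; case: b; rewrite ?eqxx ?[h1 x == _]eq_sym ?labels_neqE /=; field.
  by rewrite labels_neqE; case: b; rewrite ?eqxx ?labels_neqE /=; field.
by field; rewrite pnatr_eq0 size_eq0.
Qed.

(** The empirical errors of h1 and h2 are 1/2 - e and 1/2 + e, where e has the
    sign of the sum of the labels.  Their minimum is at most 1/2, which excludes
    any third answer since that would err everywhere; and it is attained by the
    majority label alone unless e = 0. *)
Lemma ERM_majority s w : s != [::] ->
  [/\ A (map z s) w x = h1 x \/ A (map z s) w x = h2 x,
      0 < coin_sum s -> A (map z s) w x = h1 x &
      coin_sum s < 0 -> A (map z s) w x = h2 x].
Proof.
move=> s_neq0; have [_ A_min] := A_ERM (map z s) w; move: A_min.
set h := A _ w => A_min.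
have := A_min _ Hh1; have := A_min _ Hh2.
rewrite (emp_err_vote (or_intror erefl) s_neq0) (emp_err_vote (or_introl erefl) s_neq0).
rewrite /vote eqxx labels_neqE mulN1r mulNr opprK !mul1r.
set e := _ / (2 * _) => le2 le1.
have n_gt0 : 0 < (2 * (size s)%:R) :> R.
  by rewrite mulr_gt0// ltr0n lt0n size_eq0.
have hx : h x = h1 x \/ h x = h2 x.
  have [hx1|hx1] := eqVneq (h x) (h1 x); first by left.
  have [hx2|hx2] := eqVneq (h x) (h2 x); first by right.
  suff err1 : emp_err R h (map z s) = 1.
    by rewrite err1 in le1 le2; case: (half_pm_lt1 le1 le2).
  rewrite /emp_err size_map big_map (eq_bigr (fun=> 1)); last first.
    by move=> [] _ /=; rewrite ?hx1 ?hx2.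
  by rewrite big_const_seq count_predT iter_addr_0 divff// pnatr_eq0 size_eq0.
split=> // s_sgn.
  have e_gt0 : 0 < e by rewrite divr_gt0// ltr0z.
  case: hx => // hx2; exfalso; move: le1.
  rewrite (emp_err_vote (or_intror hx2) s_neq0) /vote hx2 labels_neqE mulN1r mulNr -/e.
  by rewrite opprK mul1r lerD2l leNgt (lt_trans _ e_gt0)// oppr_lt0.
have e_lt0 : e < 0 by rewrite pmulr_llt0 ?invr_gt0// ltrz0.
case: hx => // hx1; exfalso; move: le2.
rewrite (emp_err_vote (or_introl hx1) s_neq0) /vote hx1 eqxx !mul1r -/e.
by rewrite lerD2l leNgt (lt_trans e_lt0)// oppr_gt0.
Qed.

Definition mean_vote s : R := 2 * fine (P [set w | A (map z s) w x = h1 x]) - 1.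

Lemma measurable_vote_set s : measurable [set w | A (map z s) w x = h1 x].
Proof.
have [_ _ A_meas] := A_rule.
have mA : measurable_fun setT (fun w : W => A (map z s) w x).
  have := @measurable_predict _ _ _ X Y W A A_meas _ W (size s)
     (cst (map_tuple z (in_tuple s))) id (cst x) (enum 'I_(size s)).
  rewrite /= map_tnth_enum => h; exact: h.
by have := mA measurableT _ (measurable_singleton diag_meas (h1 x)); rewrite setTI.
Qed.

(** All balanced samples of a given size are permutations of each other, so by
    permutation invariance the rule has the same mean vote on all of them. *)
Lemma mean_vote_tie_sign N : (0 < N)%N ->
  exists2 tau : R, -1 <= tau <= 1 &
    forall s, size s = N -> mean_vote s = tie_sign tau (coin_sum s).
Proof.
move=> N_gt0; pose s0 := nseq N./2 true ++ nseq N./2 false.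
have s0_sum : coin_sum s0 = 0.
  by rewrite coin_sum_count count_cat !count_nseq size_cat !size_nseq /=; lia.
exists (mean_vote s0).
  apply: sign_mean_bound.
  rewrite fine_ge0 ?measure_ge0//= -[leRHS]/(fine 1%E) fine_le ?fin_num_measure//.
    - exact: measurable_vote_set.
    - exact/probability_le1/measurable_vote_set.
move=> s sz_s; have s_neq0 : s != [::] by rewrite -size_eq0 sz_s -lt0n.
have maj w := ERM_majority w s_neq0.
rewrite /tie_sign; case: ltgtP => s_sgn.
- rewrite /mean_vote (_ : [set w | _] = setT) ?probability_setT /=; first by ring.
  by apply/seteqP; split=> // w _ /=; have [_ /(_ s_sgn)] := maj w.
- rewrite /mean_vote (_ : [set w | _] = set0) ?measure0 /=; first by ring.
  apply/seteqP; split=> // w /= Aw1; have [_ _ /(_ s_sgn) Aw2] := maj w.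
  by apply: h12; rewrite -Aw1 -Aw2.
have s_perm : perm_eq (map z s) (map z s0).
  apply/perm_map/perm_eq_coins; rewrite ?s0_sum//.
  rewrite /s0 size_cat !size_nseq.
  by move: s_sgn; rewrite coin_sum_count; lia.
have [_ A_perm _] := A_rule.
have := A_perm _ _ s_perm 1%N (fun=> x) (fun=> [set h1 x]).
rewrite /mean_vote => E; congr (2 * fine _ - 1).
have all1 (s' : seq (X * Y)) : [set w | 'I_1 -> [set h1 x] (A s' w x)] =
    [set w | A s' w x = h1 x].
  by apply/seteqP; split=> w /= Aw => [|_]; [exact: Aw ord0|].
rewrite -!all1; apply: E => _; exact: measurable_singleton.
Qed.

(** For a fixed sample the error is a linear combination of the votes of the k
    runs, so its mean over the seeds only depends on the law of each single
    seed. *)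
Lemma cv_mse_seed_ge (tau : R) n k m (b : n.-tuple bool) :
  (1 < k)%N -> (0 < m)%N -> n = (k * m)%N ->
  (forall s, size s = (k.-1 * m)%N -> mean_vote s = tie_sign tau (coin_sum s)) ->
  (((majority_cv_sum tau k m b / (2 * n%:R)) ^+ 2)%:E <=
  \int[(P \x iid P k)%E]_q ((cv_estimate R A [tuple of map z b] q.2
     - true_err (coin_law R z) (A (map z b) q.1)) ^+ 2)%:E)%E.
Proof.
move=> k_gt1 m_gt0 nE tauE.
have n_gt0 : (0 < n)%N by rewrite nE muln_gt0 m_gt0 ltnW.
have nm : (n %/ k = m)%N by rewrite nE mulKn// ltnW.
have n_neq0 : n%:R != 0 :> R by rewrite pnatr_eq0 -lt0n.
have nR : n%:R = k%:R * m%:R :> R by rewrite nE natrM.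
have k_neq0 : k%:R != 0 :> R by rewrite pnatr_eq0 -lt0n ltnW.
have m_neq0 : m%:R != 0 :> R by rewrite pnatr_eq0 -lt0n.
pose off (i : 'I_k) : seq bool := off_fold m i b.
pose c (i : 'I_k) : R := - ((coin_sum (fold m i b))%:~R / (2 * n%:R)).
pose E (i : 'I_k) := [set q : W * k.-tuple W | A (map z (off i)) (tnth q.2 i) x = h1 x].
have sz_b : size b = (k * m)%N by rewrite size_tuple.
have mE i : measurable (E i).
  have mti : measurable_fun setT (fun q : W * k.-tuple W => tnth q.2 i).
    by apply: (measurableT_comp (measurable_tnth _)).
  by have := mti measurableT _ (measurable_vote_set (off i)); rewrite setTI.
have PE i : (P \x iid P k)%E (E i) = P [set w | A (map z (off i)) w x = h1 x].
  rewrite (_ : E i = setT `*` [set t : k.-tuple W |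
       [set w | A (map z (off i)) w x = h1 x] (tnth t i)]); last first.
    by apply/seteqP; split=> -[w t] //= -[].
  have mB := measurable_vote_set (off i).
  rewrite product_measure1E//; last first.
    by have := @measurable_tnth _ W k i measurableT _ mB; rewrite setTI.
  by rewrite [X in (X * _)%E](probability_setT P) mul1e; apply: iid_tnth.
have off_neq0 i : off i != [::].
  rewrite -size_eq0 (size_off_fold (ltn_ord i) sz_b) -lt0n muln_gt0 m_gt0 andbT.
  by case: (k) k_gt1 => [|[]].
have b_neq0 : (b : seq bool) != [::] by rewrite -size_eq0 size_tuple -lt0n.
have fE q : cv_estimate R A [tuple of map z b] q.2
     - true_err (coin_law R z) (A (map z b) q.1) =
   \sum_i c i * (2 * \1_(E i) q - 1).
  have -> : true_err (coin_law R z) (A (map z b) q.1) = 1 / 2.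
    rewrite /true_err (coin_law_pred R z (fun t => A (map z b) q.1 t.1 != t.2)) /=.
    have [[->|->] _ _] := ERM_majority q.1 b_neq0.
      by rewrite eqxx [h1 x == _]eq_sym labels_neqE /= add0r.
    by rewrite eqxx labels_neqE /= addr0.
  rewrite /cv_estimate nm.
  have -> : \sum_(i < k) emp_err R (A (off_fold m i [tuple of map z b]) (tnth q.2 i))
        (fold m i [tuple of map z b]) = \sum_(i < k) (1 / 2 + k%:R * (c i * (2 * \1_(E i) q - 1))).
    apply: eq_bigr => i _; rewrite /= off_fold_map fold_map.
    have [hx _ _] := ERM_majority (tnth q.2 i) (off_neq0 i).
    rewrite emp_err_vote//; last first.
      by rewrite -size_eq0 (size_fold (ltn_ord i) sz_b) -lt0n.
    rewrite (size_fold (ltn_ord i) sz_b).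
    have -> : 2 * \1_(E i) q - 1 = vote (A (map z (off i)) (tnth q.2 i)).
      rewrite indicE /vote /E; case: eqP => Ax.
        by rewrite mem_set//=; ring.
      by rewrite memNset//=; ring.
    rewrite /c nR; field.
    by rewrite m_neq0 k_neq0.
  rewrite big_split /= sumr_const card_ord -mulr_sumr mulrDl -[_ *+ k]mulr_natr.
  field.
  exact: k_neq0.
have ->: (majority_cv_sum tau k m b / (2 * n%:R)) ^+ 2 =
    (\sum_i c i * (2 * fine ((P \x iid P k)%E (E i)) - 1)) ^+ 2.
  rewrite -sqrrN; congr (_ ^+ 2); rewrite /majority_cv_sum mulr_suml -sumrN.
  apply: eq_bigr => i _; rewrite PE -/(mean_vote _) tauE; last first.
    by rewrite (size_off_fold (ltn_ord i) sz_b).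
  by rewrite /c; ring.
under eq_integral => q _ do rewrite fE.
apply: (@sqr_integral_le _ _ _ _ _ _ (\sum_i `|c i|)); last exact: integral_sign_sum.
  apply: measurable_sum => i; apply: measurable_funM => //.
  apply: measurable_funB => //; apply: measurable_funM => //.
move=> q; apply: le_trans (ler_norm_sum _ _ _) _; apply: ler_sum => i _.
rewrite normrM ler_piMr// indicE; case: (_ \in _) => /=.
  by rewrite mulr1 (_ : 2 - 1 = 1) ?normr1//; ring.
by rewrite mulr0 sub0r normrN1.
Qed.

(** Integrate the bound for fixed samples over the sample, using Tonelli's
    theorem to integrate the seeds first. *)
Lemma cv_mse_coin_ge n k : (1 < k)%N -> (k %| n)%N -> (0 < n)%N ->
  ((Num.sqrt k%:R / n%:R / 256 ^+ 2)%:E <= cv_mse P A n k (coin_law R z))%E.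
Proof.
move=> k_gt1 kn n_gt0; pose m := (n %/ k)%N.
have nE : n = (k * m)%N by rewrite mulnC divnK.
have m_gt0 : (0 < m)%N by move: n_gt0; rewrite nE muln_gt0 => /andP[].
have N_gt0 : (0 < k.-1 * m)%N by rewrite muln_gt0 m_gt0 andbT; case: (k) k_gt1 => [|[]].
have [tau tau1 tauE] := mean_vote_tie_sign N_gt0.
have [_ _ A_meas] := A_rule.
have m_err := measurable_cv_error (R := R) diag_meas A_meas (n := n) (k := k) z.
pose Q : probability (W * k.-tuple W)%type R := (P \x iid P k)%E.
rewrite /cv_mse (fubini_tonelli1 (m2 := Q)); last 2 first.
- by apply/measurable_EFinP; exact: (measurable_funM m_err m_err).
- by move=> q; rewrite lee_fin sqr_ge0.
apply: le_trans (le_integral_iid_coin (z := z)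
  (g := fun b => (majority_cv_sum tau k m b / (2 * n%:R)) ^+ 2) _ _ _).
- have n_gt0R : 0 < n%:R :> R by rewrite ltr0n.
  rewrite lee_fin.
  have -> : mean n (fun b => (majority_cv_sum tau k m b / (2 * n%:R)) ^+ 2) =
      (2 * n%:R) ^- 2 * mean n (fun b => majority_cv_sum tau k m b ^+ 2).
    by rewrite -meanZ; apply: eq_mean => b _; rewrite exprMn exprVn mulrC.
  have := mean_majority_cv_sum_sq tau1 k_gt1 m_gt0; rewrite -nE.
  move=> mean_ge; have sc_ge0 : 0 <= (2 * n%:R) ^- 2 :> R.
    by rewrite invr_ge0 exprn_ge0// mulr_ge0.
  apply: le_trans (ler_wpM2l sc_ge0 mean_ge).
  rewrite le_eqVlt; apply/orP; left; apply/eqP; field.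
  by rewrite gt_eqF.
- by apply: measurable_fun_fubini_tonelli_F => [|q];
     [apply/measurable_EFinP; exact: (measurable_funM m_err m_err)|
      rewrite lee_fin sqr_ge0].
- by move=> S; apply: integral_ge0 => q _; rewrite lee_fin sqr_ge0.
move=> b; exact: (cv_mse_seed_ge b k_gt1 m_gt0 nE tauE).
Qed.

End TwoLabels.

Theorem corollary10
  (R : realType) (dX dY dW : measure_display)
  (X : measurableType dX) (Y : measurableType dY) (W : measurableType dW)
  (loss_meas : measurable [set p : Y * Y | p.1 = p.2])
  (H : set (X -> Y))
  (H_ge2 : exists h1 h2 : X -> Y, [/\ H h1, H h2 & h1 <> h2])
  (P : probability W R) (A : seq (X * Y) -> W -> X -> Y)
  (A_rule : learning_rule H P A)
  (A_ERM : is_ERM R H A)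
  (kstar : nat -> nat)
  (kstar_opt : forall n, (2 <= n)%N -> optimal_folds P A n (kstar n)) :
  is_Omega (cv_risk P A) (fun n => Num.sqrt (kstar n)%:R / n%:R).
Proof.
have [h1 [h2 [Hh1 Hh2 h12]]] := H_ge2.
have [x hx] : exists x, h1 x <> h2 x.
  by apply: contrapT => same; apply: h12; apply/funext => x;
     apply: contrapT => hx; apply: same; exists x.
exists (256 ^- 2); first by rewrite invr_gt0 exprn_gt0// ltr0n.
exists 2%N => // n /= n_ge2.
have [[k_ge2 kn] <-] := kstar_opt n n_ge2.
rewrite mulrC.
apply: le_trans (cv_mse_coin_ge loss_meas A_rule A_ERM Hh1 Hh2 hx k_ge2 kn (ltnW n_ge2)) _.
by apply: ereal_sup_ubound; exists (coin_law R (coin_example h1 h2 x)).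
Qed.
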